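(* Let $\mathcal{D}$ and $\mathcal{F}$ be a diffeology and a Sikorski structure on a set $X$. For a subset $V\subseteq X$, let $\mathcal{D}_V$ and $\mathcal{F}_V$ be the subset diffeology and the subspace Sikorski structure on $V$. If the triple $(\mathcal{D},X,\mathcal{F})$ is compatible and $V\subset X$ is any subset, then the triple $(\mathcal{D}_V,V,\mathcal{F}_V)$ is compatible. If the triple $(\mathcal{D},X,\mathcal{F})$ is reflexive and $V\subset X$ is an open subset in the initial topology (induced by $\mathcal{F}$), then the triple $(\mathcal{D}_V,V,\mathcal{F}_V)$ is reflexive.
   Context: ''Smooth'' means $C^\infty$. A cartesian space is $\mathbb{R}^d$ for some $d\in\mathbb{N}$, with its standard smooth structure. Sikorski structures. A Sikorski structure on a set $X$ is a non-empty collection $\mathcal{F}_X$ of real-valued functions on $X$ such that, with $X$ equipped with the initial topology (the weakest topology making all functions in $\mathcal{F}_X$ continuous): (S1) if $f_1,\ldots,f_n\in\mathcal{F}_X$ and $g\in C^\infty(\mathbb{R}^n)$, then $g\circ(f_1,\ldots,f_n)\in\mathcal{F}_X$; (S2) given $f\colon X\to\mathbb{R}$, if for each point of $X$ there exist a neighbourhood $V$ and $g\in\mathcal{F}_X$ with $g|_V=f|_V$, then $f\in\mathcal{F}_X$. A map between Sikorski spaces $(X,\mathcal{F}_X)\to(Y,\mathcal{F}_Y)$ is Sikorski smooth if its composition with every function in $\mathcal{F}_Y$ is in $\mathcal{F}_X$. A manifold (in particular an open subset of a cartesian space) carries the Sikorski structure of all $C^\infty$ real-valued functions. For a subset $V$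 of a Sikorski space $(X,\mathcal{F}_X)$, the subspace Sikorski structure is the set of functions $f\colon V\to\mathbb{R}$ such that each point of $V$ has a neighbourhood $W$ in $X$ and a function $g\in\mathcal{F}_X$ with $g|_{V\cap W}=f|_{V\cap W}$. Diffeologies. A diffeology on a set $X$ is a collection $\mathcal{D}_X$ of maps (plots) from open subsets of cartesian spaces to $X$ such that: (D1) constant maps are plots; (D2) precompositions of plots with $C^\infty$ maps between open subsets of cartesian spaces are plots; (D3) $p\colon U\to X$ is a plot if each point of $U$ has a neighbourhood $V$ with $p|_V$ a plot. A map between diffeological spaces is diffeologically smooth if its precomposition with every plot of the source is a plot of the target; a manifold carries the diffeology of all $C^\infty$ maps from open subsets of cartesian spaces. For a subset $V$ of a diffeological space $(X,\mathcal{D}_X)$, the subset diffeology is the set of maps $p\colon U\to V$ from open subsets $U$ of cartesian spaces whose composition with the inclusion $V\to X$ is in $\mathcal{D}_X$. For a Sikorski structure $\mathcal{F}_X$, $\Pi\mathcal{F}_X$ denotes the diffeology of all Sikorski smooth maps from open subsets of cartesian spaces to $X$. For a diffeology $\mathcal{D}_X$, $\Phi\mathcal{D}_X$ denotes the Sikorski structure of all diffeologically smooth real-valued functions on $X$. A triple $(\mathcal{D}_X,X,\mathcal{F}_X)$ is compatible if $f\circ p$ is smooth for all $p\in\mathcal{D}_X$ and $f\in\mathcal{F}_X$; it is reflexive if $\Phi\mathcal{D}_X=\mathcal{F}_X$ and $\Pi\mathcal{F}_X=\mathcal{D}_X$. *)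

(* Defs.v *)
From HB Require Import structures.
From mathcomp Require Import all_boot all_order all_algebra.
From mathcomp Require Import all_classical all_reals all_analysis.
Import Order.TTheory GRing.Theory Num.Theory.
Import numFieldNormedType.Exports.

Set Implicit Arguments.
Unset Strict Implicit.
Unset Printing Implicit Defensive.

Local Open Scope classical_set_scope.
Local Open Scope ring_scope.

(* [partials [:: i1; ..; ik] f] is the iterated partial derivative of f along
   the coordinates ik, then .., then i1.  It is a total function: its value is
   meaningful at a point x only if the derivatives involved exist near x, which
   [smooth_on] requires at every order. *)
Definition partials (R : realType) (d : nat) (W : normedModType R)
    (s : seq 'I_d) (f : 'rV[R]_d -> W) : 'rV[R]_d -> W :=
  foldr (fun i g => 'D_(delta_mx 0 i) g) f s.

(* For an open set A: f is C^oo on A, i.e. all its iterated partial derivatives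
   exist and are continuous on A.  For d = 0 this is automatic. *)
Definition smooth_on (R : realType) (d : nat) (W : normedModType R)
    (A : set 'rV[R]_d) (f : 'rV[R]_d -> W) : Prop :=
  forall (s : seq 'I_d) (x : 'rV[R]_d), A x ->
    {for x, continuous (partials s f)} /\
    forall i : 'I_d, derivable (partials s f) x (delta_mx 0 i).

(* Open subsets of cartesian spaces.  Through [set_type], a [domain] is also
   used as the type of its points. *)
Record domain (R : realType) := Domain {
  dim : nat;
  carrier :> set 'rV[R]_dim;
  open_carrier : open carrier }.
Arguments Domain {R dim carrier}.

(* Smoothness of a map defined on U only: p is extended by 0 outside U, which
   does not affect the derivatives at points of the open set U. *)
Definition smooth (R : realType) (W : normedModType R) (U : domain R)
    (p : U -> W) : Prop :=
  smooth_on U ('valL_ 0 p).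

Definition smooth_between (R : realType) (U V : domain R) (h : V -> U) : Prop :=
  smooth (fun v => val (h v)).

(* A collection of maps from open subsets of cartesian spaces to X. *)
Definition plots (R : realType) (X : Type) :=
  forall U : domain R, set (U -> X).

Record is_diffeology (R : realType) (X : Type) (D : plots R X) : Prop := {
  plot_cst : forall (U : domain R) (x : X), D U (fun=> x);
  plot_comp : forall (U V : domain R) (p : U -> X) (h : V -> U),
    D U p -> smooth_between h -> D V (p \o h);
  plot_local : forall (U : domain R) (p : U -> X),
    (forall u : U, exists (W : set 'rV[R]_(dim U)) (oW : open W)
        (WU : W `<=` U), W (val u) /\ D (Domain oW) (p \o subfun WU)) ->
    D U p }.

(* X with the weakest topology making all functions in F continuous; [{classic X}]
   is X itself, with the choice structure the topology library asks for. *)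
Definition initial_space (R : realType) (X : Type) (F : set (X -> R)) :
    topologicalType :=
  sup_topology (fun f : F =>
    Topological.on (initial_topology (val f : {classic X} -> R))).

Record is_sikorski (R : realType) (X : Type) (F : set (X -> R)) : Prop := {
  sikorski_nonempty : F !=set0;
  sikorski_comp : forall (n : nat) (f : 'I_n -> X -> R) (g : 'rV[R]_n -> R),
    (forall i, F (f i)) -> smooth_on setT g ->
    F (fun x => g (\row_i f i x));
  sikorski_local : forall f : X -> R,
    (forall x : X, exists2 V : set X, nbhs (x : initial_space F) V &
      exists2 g, F g & forall y, V y -> g y = f y) ->
    F f }.

Definition sikorski_smooth (R : realType) (X Y : Type) (FX : set (X -> R))
    (FY : set (Y -> R)) (h : X -> Y) : Prop :=
  forall f, FY f -> FX (f \o h).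

Definition diff_smooth (R : realType) (X Y : Type) (DX : plots R X)
    (DY : plots R Y) (h : X -> Y) : Prop :=
  forall (U : domain R) (p : U -> X), DX U p -> DY U (h \o p).

(* The standard Sikorski structure of an open subset of a cartesian space. *)
Definition std_sikorski (R : realType) (U : domain R) : set (U -> R) :=
  [set f | smooth f].

(* The standard diffeology of the manifold R. *)
Definition std_diffeology (R : realType) : plots R R :=
  fun U => [set p | smooth p].

Definition Pi (R : realType) (X : Type) (F : set (X -> R)) : plots R X :=
  fun U => [set p | sikorski_smooth (@std_sikorski R U) F p].

Definition Phi (R : realType) (X : Type) (D : plots R X) : set (X -> R) :=
  [set f | diff_smooth D (@std_diffeology R) f].

Definition compatible_triple (R : realType) (X : Type) (D : plots R X)
    (F : set (X -> R)) : Prop :=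
  forall (U : domain R) (p : U -> X) (f : X -> R),
    D U p -> F f -> smooth (f \o p).

Definition reflexive_triple (R : realType) (X : Type) (D : plots R X)
    (F : set (X -> R)) : Prop :=
  Phi D = F /\ Pi F = D.

Definition subset_diffeology (R : realType) (X : Type) (D : plots R X)
    (V : set X) : plots R V :=
  fun U => [set p | D U (fun u => val (p u))].
Arguments subset_diffeology {R X} D V U _.

Definition subspace_sikorski (R : realType) (X : Type) (F : set (X -> R))
    (V : set X) : set (V -> R) :=
  [set f | forall v : V,
    exists2 W : set X, nbhs (val v : initial_space F) W &
    exists2 g, F g & forall w : V, W (val w) -> g (val w) = f w].
Arguments subspace_sikorski {R X} F V _.

(* Main.v *)
Require Import Defs.
From mathcomp Require Import all_boot all_order all_algebra.
From mathcomp Require Import all_classical all_reals all_analysis.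
From mathcomp Require Import ring lra.
Import Order.TTheory GRing.Theory Num.Theory.
Import numFieldNormedType.Exports.

Set Implicit Arguments.
Unset Strict Implicit.
Unset Printing Implicit Defensive.

Local Open Scope classical_set_scope.
Local Open Scope ring_scope.

(** Write D for the diffeology and F for the Sikorski structure.

    Compatibility passes to any subset V because a function of the subspace
    structure is, near each point of V, the restriction of some g in F: along a
    plot p of V it agrees near each parameter with the smooth function g \o p
    ([compatible_subset]).  The one topological input is that a plot pulls
    neighbourhoods in the initial topology back to neighbourhoods
    ([plot_nbhs]).  This rests on [nbhs_gauge]: every neighbourhood W of v
    contains a set {q < 1} with q in F nonnegative and q v = 0, and q \o p is
    continuous because it is smooth.

    Let now the triple be reflexive and V open.  Each g in F restricts to a
    function of the subspace structure, so a map into V that is Sikorski smooth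
    for the subspace structure is Sikorski smooth into X, hence a plot of X
    ([Pi_subspace_sikorski]).

    The remaining inclusion says that a function f on V which is smooth along
    every plot of V agrees near each v in V with some g in F
    ([Phi_subset_diffeology]).  Take a gauge q of V at v and cut f off: let
    g = b * f on V and 0 elsewhere, where b in F equals 1 for q <= 1/3 and 0
    for q >= 2/3 ([sikorski_cutoff]).  By reflexivity g is in F as soon as it
    is smooth along every plot p of X.  Near a parameter sent into V, p is a
    plot of V and g \o p is a product of smooth functions; near any other
    parameter q > 2/3, so that g \o p vanishes.

    The calculus needed is that smooth functions are closed under sums and
    products ([smooth_onD], [smooth_onM]) and that a flat function exists, that
    is, t |-> exp (-1/t) extended by 0 to t <= 0 ([smooth_flat]).  Both come
    from one principle ([smooth_on_coind]): a class of continuous functions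
    with partial derivatives in the same class consists of smooth functions. *)

(** * Smooth functions on open sets of a cartesian space *)

Section SmoothOn.
Context {R : realType} {d : nat}.
Implicit Types (A B : set 'rV[R]_d).

Section General.
Context {W : normedModType R}.
Implicit Types (f g : 'rV[R]_d -> W).

Lemma partials_near f g (x : 'rV[R]_d) (s : seq 'I_d) :
  (\forall y \near x, f y = g y) ->
  \forall y \near x, partials s f y = partials s g y.
Proof.
move=> fg; elim: s => //= i s IH.
have := near_join IH; apply: filterS => y.
exact: near_eq_derive.
Qed.

(** The iterated derivatives at x depend only on the germ at x, so smoothness
    may be checked by comparison with a known smooth function near each point. *)
Lemma smooth_on_near A f :
  (forall x, A x -> exists B g,
    [/\ B x, smooth_on B g & \forall y \near x, g y = f y]) ->
  smooth_on A f.
Proof.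
move=> Af s x /Af[B [g [Bx sg gf]]]; have [cg dg] := sg s x Bx.
have gfs := partials_near s gf; split=> [|i]; last first.
  exact: near_eq_derivable gfs (dg i).
rewrite /prop_for /continuous_at -(nbhs_singleton gfs).
exact: cvg_trans (near_eq_cvg gfs) cg.
Qed.

Lemma smooth_on_sub A B f : A `<=` B -> smooth_on B f -> smooth_on A f.
Proof. by move=> AB sf s x /AB; exact: sf. Qed.

Lemma smooth_on_deriv A f (i : 'I_d) :
  smooth_on A f -> smooth_on A ('D_(delta_mx 0 i) f).
Proof.
move=> sf s x Ax; have := sf (rcons s i) x Ax.
by rewrite /partials foldr_rcons.
Qed.

(** By induction on the multi-index, each iterated partial derivative of a
    function of S coincides on A with a function of S; agreement on the open set
    A is enough, as derivatives are local.  This replaces explicit formulas for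
    higher derivatives, such as the Leibniz rule. *)
Lemma smooth_on_coind A (S : set ('rV[R]_d -> W)) :
  open A ->
  (forall f, S f -> forall x, A x -> {for x, continuous f} /\
     forall i : 'I_d, derivable f x (delta_mx 0 i)) ->
  (forall f (i : 'I_d), S f ->
     exists2 g, S g & forall x, A x -> 'D_(delta_mx 0 i) f x = g x) ->
  forall f, S f -> smooth_on A f.
Proof.
move=> oA S0 S1 f Sf.
have near_A g h x : A x -> (forall y, A y -> g y = h y :> W) ->
    \forall y \near x, g y = h y.
  by move=> Ax gh; apply: filterS (open_nbhs_nbhs (conj oA Ax)).
have [s|g_ gP] := @choice _ _ (fun s g =>
    S g /\ forall x, A x -> partials s f x = g x).
  elim: s => [|i s [g [Sg sg]]]; first by exists f.
  have [h Sh gh] := S1 g i Sg; exists h; split=> // x Ax /=.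
  rewrite -gh//; apply: near_eq_derive; exact: near_A.
move=> s x Ax; have [Sg fg] := gP s; have [cg dg] := S0 _ Sg x Ax.
have gf : \forall y \near x, g_ s y = partials s f y.
  by apply: near_A => // y Ay; rewrite fg.
split=> [|i]; last exact: near_eq_derivable gf (dg i).
rewrite /prop_for /continuous_at -(nbhs_singleton gf).
exact: cvg_trans (near_eq_cvg gf) cg.
Qed.

Lemma smooth_on_cst A (c : W) : open A -> smooth_on A (cst c).
Proof.
move=> oA; apply: (@smooth_on_coind A (range (fun c => cst c))) => //.
- move=> _ [b _ <-] x _; split=> [|i]; first exact: cst_continuous.
  exact: derivable_cst.
- move=> _ i [b _ <-]; exists (cst 0) => [|x _]; first by exists 0.
  exact: derive_val.
Qed.

End General.

Lemma smooth_on_coord A (j : 'I_d) :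
  open A -> smooth_on A (fun x : 'rV[R]_d => x 0 j : R).
Proof.
move=> oA; pose c := fun x : 'rV[R]_d => x 0 j : R.
apply: (@smooth_on_coind _ A [set f | f = c \/ exists b, f = cst b]) => //.
- move=> f [->|[b ->]] x _.
    split=> [|i]; first exact: coord_continuous.
    exact/diff_derivable/differentiable_coord.
  split=> [|i]; first exact: cst_continuous.
  exact: derivable_cst.
- move=> f i [->|[b ->]]; last first.
    by exists (cst 0) => [|x _]; [right; eexists | exact: derive_val].
  exists (cst (c (delta_mx 0 i))) => [|x _]; first by right; eexists.
  (* The coordinates of the derivative of the identity are the derivatives of
     the coordinates. *)
  have := derive_mx (@derivable_id R 'rV[R]_d x (delta_mx 0 i)).
  rewrite derive_id => /(congr1 (fun M : 'rV[R]_d => M 0 j)).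
  by rewrite [in X in _ = X]mxE /c/= => ->.
- by left.
Qed.

(** The algebra generated by the smooth functions.  By the Leibniz rule it is
    stable under partial derivatives, so that [smooth_on_coind] applies to it;
    the products alone would not be stable. *)
Inductive smooth_alg A : set ('rV[R]_d -> R) :=
| alg_smooth f : smooth_on A f -> smooth_alg A f
| alg_add f g : smooth_alg A f -> smooth_alg A g -> smooth_alg A (f + g)
| alg_mul f g : smooth_alg A f -> smooth_alg A g -> smooth_alg A (f * g).

Lemma smooth_alg_smooth A f : open A -> smooth_alg A f -> smooth_on A f.
Proof.
move=> oA.
have S0 h : smooth_alg A h -> forall x, A x -> {for x, continuous h} /\
    forall i : 'I_d, derivable h x (delta_mx 0 i).
  elim=> {h} [h sh|h k _ IHh _ IHk|h k _ IHh _ IHk] x Ax.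
  - exact: sh [::] x Ax.
  - have [ch dh] := IHh x Ax; have [ck dk] := IHk x Ax; split=> [|i].
      exact: continuousD.
    exact: derivableD.
  - have [ch dh] := IHh x Ax; have [ck dk] := IHk x Ax; split=> [|i].
      exact: continuousM.
    exact: derivableM.
apply: smooth_on_coind => // h i.
elim=> {h} [h sh|h k Sh [h' Sh' hh'] Sk [k' Sk' kk']|
  h k Sh [h' Sh' hh'] Sk [k' Sk' kk']].
- exists ('D_(delta_mx 0 i) h) => //; exact/alg_smooth/smooth_on_deriv.
- exists (h' + k') => [|x Ax]; first exact: alg_add.
  by rewrite deriveD ?hh' ?kk'//; [case: (S0 h Sh x Ax)|case: (S0 k Sk x Ax)].
- exists (h * k' + k * h') => [|x Ax]; first by apply: alg_add; exact: alg_mul.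
  by rewrite deriveM ?hh' ?kk'//; [case: (S0 h Sh x Ax)|case: (S0 k Sk x Ax)].
Qed.

Lemma smooth_onD A (f g : 'rV[R]_d -> R) :
  open A -> smooth_on A f -> smooth_on A g -> smooth_on A (f + g).
Proof.
move=> oA sf sg; apply: smooth_alg_smooth => //.
by apply: alg_add; exact: alg_smooth.
Qed.

Lemma smooth_onM A (f g : 'rV[R]_d -> R) :
  open A -> smooth_on A f -> smooth_on A g -> smooth_on A (f * g).
Proof.
move=> oA sf sg; apply: smooth_alg_smooth => //.
by apply: alg_mul; exact: alg_smooth.
Qed.

End SmoothOn.

(** * Flat functions *)

Section Flat.
Context {R : realType}.
Implicit Types (t : R) (p : {poly R}).

(** The polynomial factor makes the family stable under derivatives; the
    classical flat function is [flat 1]. *)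
Definition flat p t : R := if 0 < t then p.[t^-1] * expR (- t^-1) else 0.

(** With u = 1/t this is the bound u^(k+1) / (k+1)! <= exp u. *)
Lemma flat_monomial_le k t :
  0 < t -> t^-1 ^+ k * expR (- t^-1) <= k.+1`!%:R * t.
Proof.
move=> t0; have u0 : 0 < t^-1 by rewrite invr_gt0.
have : t^-1 ^+ k.+1 / k.+1`!%:R <= expR t^-1.
  by apply: le_trans (expR_ge1Dxn k (ltW u0)); rewrite lerDr.
rewrite ler_pdivrMr ?ltr0n ?fact_gt0// => le.
rewrite expRN ler_pdivrMr ?expR_gt0// -(ler_pM2l u0) -exprS.
rewrite (le_trans le)// [leRHS]mulrC -!mulrA [t * _]mulrCA mulfV ?gt_eqF//.
by rewrite mulr1 mulrC.
Qed.

Lemma flat_le p : exists C : R, forall t, `|flat p t| <= C * `|t|.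
Proof.
exists (\sum_(i < size p) `|p`_i| * i.+1`!%:R) => t; rewrite /flat.
case: ifPn => [t0|_]; last by rewrite normr0 mulr_ge0 ?sumr_ge0.
rewrite horner_coef !mulr_suml (le_trans (ler_norm_sum _ _ _))//.
apply: ler_sum => i _; rewrite -!mulrA normrM ler_wpM2l//.
rewrite ger0_norm ?mulr_ge0 ?expR_ge0 ?exprn_ge0 ?invr_ge0 ?(ltW t0)//.
by rewrite (gtr0_norm t0) flat_monomial_le.
Qed.

Lemma flat_cvg0 p : flat p @ (0 : R)^' --> (0 : R).
Proof.
have [C pC] := flat_le p.
have C0 : (fun h : R => C * `|h|) @ (0 : R)^' --> (0 : R).
  rewrite -[X in _ --> X](mulr0 C); apply: cvgM; first exact: cvg_cst.
  rewrite -[X in _ --> X](@normr0 _ R); apply: cvg_norm.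
  by apply: cvg_within_filter; exact: cvg_id.
apply: (@squeeze_cvgr _ _ _ _ (fun h => - (C * `|h|))
  (fun h => C * `|h|)) => //.
  by near=> h; rewrite -ler_norml.
by rewrite -[X in _ --> X]oppr0; exact: cvgN.
Unshelve. all: by end_near.
Qed.

Lemma is_derive_inv t : t != 0 -> is_derive t 1 (@GRing.inv R) (- t^-1 ^+ 2).
Proof.
move=> t0; apply: DeriveDef; first exact: derivableV.
by rewrite (@deriveV _ _ id)// derive_id exprVn [LHS]mulr1.
Qed.

(** For t > 0 the chain rule with u = 1/t, u' = - u^2, turns p(u) exp (-u) into
    u^2 (p(u) - p'(u)) exp (-u).  At 0 the difference quotient of [flat p] is
    [flat ('X * p)], which tends to 0. *)
Lemma is_derive_flat p t :
  is_derive t 1 (flat p) (flat ('X^2 * (p - p^`())) t).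
Proof.
have [t0|t0|->] := ltgtP t 0.
- rewrite /flat !ifN -?leNgt ?ltW//.
  apply: (@near_eq_is_derive _ _ _ (cst 0)).
  near=> x; rewrite ifN// -leNgt ltW//; near: x; exact: lt_nbhsl.
- rewrite /flat !ifT//.
  apply: (@near_eq_is_derive _ _ _
    ((horner p \o @GRing.inv R) * (expR \o (- (@GRing.inv R))))).
    by near=> x; rewrite ifT//; last by near: x; exact: lt_nbhsr.
  have du := is_derive_inv (lt0r_neq0 t0).
  have dp := @is_derive1_comp _ (horner p) _ t _ _ (is_derive_poly _ _) du.
  have de := @is_derive1_comp _ expR (- (@GRing.inv R)) t _ _
    (is_derive_expR _) (is_deriveN du).
  apply: is_derive_eq.
  rewrite hornerM hornerXn hornerD hornerN opprfctE /GRing.scale/=.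
  ring.
- rewrite {2}/flat ltxx.
  have lim0 : (fun h => h^-1 *: ((flat p \o shift 0) (h *: 1) - flat p 0))
     @ 0^' --> (0 : R).
    rewrite (_ : (fun h => _) = flat ('X * p)); first exact: flat_cvg0.
    apply/funext => h; rewrite /flat/= addr0 ltxx subr0 scaler1.
    by case: ifPn => _; rewrite ?scaler0// !hornerE -mulrA.
  apply: DeriveDef; first by apply/cvg_ex; exists 0.
  exact: cvg_lim lim0.
Unshelve. all: by end_near.
Qed.

Lemma smooth_flat p :
  smooth_on [set: 'rV[R]_1] (fun x : 'rV[R]_1 => flat p (x 0 0)).
Proof.
pose lift p (x : 'rV[R]_1) := flat p (x 0 0).
have quotE q x (i : 'I_1) :
    (fun h => h^-1 *: ((lift q \o shift x) (h *: delta_mx 0 i) - lift q x)) =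
    (fun h => h^-1 *: ((flat q \o shift (x 0 0)) (h *: 1) - flat q (x 0 0))).
  by apply/funext => h; rewrite /lift/= !mxE !ord1 eqxx.
apply: (@smooth_on_coind _ _ _ setT (range lift)); first exact: openT.
- move=> _ [q _ <-] x _; split=> [|i]; last first.
    rewrite /derivable quotE.
    exact: (@ex_derive _ _ _ _ _ _ _ (is_derive_flat q (x 0 0))).
  apply: (@continuous_comp _ _ _ (fun x : 'rV[R]_1 => x 0 0) (flat q)).
    exact: coord_continuous.
  apply/differentiable_continuous/derivable1_diffP.
  exact: (@ex_derive _ _ _ _ _ _ _ (is_derive_flat q (x 0 0))).
- move=> _ i [q _ <-].
  exists (lift ('X^2 * (q - q^`()))) => [|x _]; first by eexists.
  rewrite /derive quotE.
  exact: (@derive_val _ _ _ _ _ _ _ (is_derive_flat q (x 0 0))).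
- by exists p.
Qed.

End Flat.

(** * Functions of a Sikorski structure *)

Section Sikorski.
Context {R : realType} {X : Type} {F : set (X -> R)}.
Hypothesis hF : is_sikorski F.
Implicit Types (f g q : X -> R) (x v : X).

Lemma sikorski_comp1 (h : R -> R) f :
  smooth_on [set: 'rV[R]_1] (fun y : 'rV[R]_1 => h (y 0 0)) ->
  F f -> F (h \o f).
Proof.
move=> sh Ff; have := sikorski_comp hF (f := fun=> f) (fun=> Ff) sh.
by congr (F _); apply/funext => x; rewrite mxE.
Qed.

Lemma sikorski_cst (c : R) : F (cst c).
Proof.
have [f Ff] := sikorski_nonempty hF.
apply: (@sikorski_comp1 (cst c) f) => //; exact: (smooth_on_cst c openT).
Qed.

Lemma sikorski_comp2 (h : R -> R -> R) f g :
  smooth_on [set: 'rV[R]_2] (fun y : 'rV[R]_2 => h (y 0 0) (y 0 1)) ->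
  F f -> F g -> F (fun x => h (f x) (g x)).
Proof.
move=> sh Ff Fg.
have Ffg (i : 'I_2) : F (if i == 0 then f else g) by case: ifP.
have := sikorski_comp hF Ffg sh.
by congr (F _); apply/funext => x; rewrite !mxE.
Qed.

Lemma sikorskiD f g : F f -> F g -> F (f + g).
Proof.
apply: (@sikorski_comp2 +%R).
apply: (smooth_onD openT); exact: (smooth_on_coord _ openT).
Qed.

Lemma sikorskiM f g : F f -> F g -> F (f * g).
Proof.
apply: (@sikorski_comp2 *%R).
apply: (smooth_onM openT); exact: (smooth_on_coord _ openT).
Qed.

(** The sets W with such a gauge q form a filter, since the sum of a gauge of A
    and a gauge of B is a gauge of the intersection; and the preimage under f
    in F of the ball of radius e at f v has the gauge ((f - f v) / e)^2.  Hence
    the filter converges to v for the initial topology of each f. *)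
Lemma nbhs_gauge v (W : set X) : nbhs (v : initial_space F) W ->
  exists q, [/\ F q, q v = 0, forall x, 0 <= q x & forall x, q x < 1 -> W x].
Proof.
pose G : set_system {classic X} := [set W : set X |
  exists q, [/\ F q, q v = 0, forall x, 0 <= q x & forall x, q x < 1 -> W x]].
have FG : Filter G.
  split=> [ |A B [p [Fp p0 p_ge0 pA]] [q [Fq q0 q_ge0 qB]]
           |A B AB [q [Fq q0 q_ge0 qA]]].
  - by exists (cst 0); split=> //; exact: sikorski_cst.
  - exists (p + q); split=> [ | | |x].
    + exact: sikorskiD.
    + by rewrite addrfctE p0 q0 addr0.
    + by move=> x; rewrite addrfctE addr_ge0.
    + rewrite addrfctE => pq1; split; [apply: pA|apply: qB];
        apply: le_lt_trans pq1; by rewrite ?lerDl ?lerDr.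
  - by exists q; split=> // x /qA/AB.
apply: ((cvg_sup (fun f : F =>
    Topological.on (initial_topology (val f : {classic X} -> R)))
  (v : {classic X}) FG).2 _ W).
move=> [f fF] A /=; have {fF}Ff : F f by exact/set_mem.
rewrite (@nbhsE (initial_topology (f : {classic X} -> R))).
move=> -[_ [ [B oB <-] Bfv] BA].
have /nbhs_ballP[e /= e0 eB] : nbhs (f v) B by exact: open_nbhs_nbhs.
pose r := cst e^-1 * (f + cst (- f v)).
exists (r * r); split=> [ | |x|x].
- have Fr : F r.
    apply: sikorskiM; last apply: sikorskiD => //; exact: sikorski_cst.
  exact: sikorskiM.
- by rewrite /r !fctE /= subrr mulr0 mulr0.
- by rewrite /r mulrfctE -expr2 sqr_ge0.
- rewrite /r !fctE/= -expr2 -real_normK ?num_real// expr_lt1//.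
  rewrite normrM normfV (gtr0_norm e0) ltr_pdivrMl// mulr1 => fxe.
  by apply/BA/eB; rewrite /ball/= distrC.
Qed.

Lemma nbhs_sikorski_lt f v (c : R) : F f -> f v < c ->
  nbhs (v : initial_space F) [set x | f x < c].
Proof.
move=> Ff fvc.
have : (nbhs (v : initial_space F)) --> (v : initial_space F) by [].
move=> /(cvg_sup (fun f : F =>
    Topological.on (initial_topology (val f : {classic X} -> R)))
  (v : {classic X}) _).1 /(_ (SigSub (mem_set Ff)) [set x | f x < c]).
apply.
exact: (@initial_continuous {classic X} R f v
  [set y | y < c] (lt_nbhsl fvc)).
Qed.

(** With fl the flat function and c = fl (1/3), the composite
    fl (c - fl (t - 1/3)) has the constant value fl c > 0 for t <= 1/3, and
    vanishes for t >= 2/3 because fl is nondecreasing.  Nesting fl in this way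
    yields a plateau on both sides without dividing by a function. *)
Lemma sikorski_cutoff q : F q -> exists b,
  [/\ F b, forall x, q x <= 1/3 -> b x = 1 & forall x, 2/3 <= q x -> b x = 0].
Proof.
move=> Fq; pose fl := @flat R 1.
have fl_pos t : 0 < t -> 0 < fl t.
  by move=> t0; rewrite /fl /flat t0 hornerC mul1r expR_gt0.
have fl_neg t : t <= 0 -> fl t = 0 by rewrite /fl /flat ltNge => ->.
pose c := fl (1/3).
have c0 : 0 < c by apply: fl_pos; lra.
have flF f : F f -> F (fl \o f) by apply: sikorski_comp1; exact: smooth_flat.
exists (cst (fl c)^-1 *
  (fl \o (cst c + cst (-1) * (fl \o (q + cst (- (1/3))))))).
split=> [|x qx|x qx].
- apply: sikorskiM; first exact: sikorski_cst.
  apply/flF/sikorskiD; first exact: sikorski_cst.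
  apply: sikorskiM; first exact: sikorski_cst.
  apply/flF/sikorskiD => //; exact: sikorski_cst.
- rewrite !fctE/= [fl (q x - _)]fl_neg; last by lra.
  by rewrite mulr0 addr0 mulVf ?gt_eqF ?fl_pos.
- rewrite !fctE/= [fl (c + _)]fl_neg ?mulr0//.
  have -> : c + -1 * fl (q x - 1/3) = c - fl (q x - 1/3) by ring.
  rewrite subr_le0 /c /fl /flat ifT ?ifT; [|lra|lra].
  rewrite !hornerC !mul1r ler_expR lerN2 lef_pV2 ?posrE; lra.
Qed.

End Sikorski.

(** * Maps defined on a domain *)

Lemma valL_val (T S : Type) (A : set T) (c : S) (f : A -> S) (a : A) :
  'valL_c f (val a) = f a.
Proof. exact: (congr1 (@^~ a) (valLK c f)). Qed.

Section Smooth.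
Context {R : realType}.
Implicit Types U : domain R.

Lemma domain_val U (x : 'rV[R]_(Defs.dim U)) :
  (U : set _) x -> exists u : U, val u = x.
Proof. by move=> Ux; exists (SigSub (mem_set Ux)). Qed.

Lemma smooth_restrict U (A : set 'rV[R]_(Defs.dim U)) (oA : open A)
    (f : U -> R) (h : Domain oA -> R) :
  (forall y : Domain oA, exists2 w : U, val w = val y & f w = h y) ->
  smooth f -> smooth h.
Proof.
move=> fh sf; apply: smooth_on_near => x Ax.
have [x' x'E] := @domain_val (Domain oA) x Ax.
have [w wx _] := fh x'.
exists U, ('valL_0 f); split=> //.
  by rewrite -x'E -wx; exact: set_valP.
apply: filterS (open_nbhs_nbhs (conj oA Ax)) => y Ay.
have [y' <-] := @domain_val (Domain oA) y Ay.
by have [z zy fz] := fh y'; rewrite -{1}zy !valL_val.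
Qed.

Lemma smooth_continuous U (f : U -> R) (u : U) :
  smooth f -> 'valL_0 f @ val u --> f u.
Proof.
move=> /(_ [::] (val u) (set_valP u))[+ _].
by rewrite -[X in _ --> X](valL_val 0).
Qed.

Lemma near_domain U (u : U) (P : U -> Prop) :
  (\forall y \near val u, forall w : U, val w = y -> P w) ->
  \forall y \near val u, exists2 w : U, val w = y & P w.
Proof.
have := open_nbhs_nbhs (conj (@open_carrier _ U) (set_valP u)).
by apply: filterS2 => y /domain_val[w wy] Pw; exists w => //; exact: Pw.
Qed.

Lemma smooth_near_lt U (f : U -> R) (u : U) (c : R) : smooth f -> f u < c ->
  \forall y \near val u, exists2 w : U, val w = y & f w < c.
Proof.
move=> sf fuc; apply: near_domain.
have : \forall y \near val u, 'valL_0 f y < c.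
  exact: smooth_continuous sf _ (lt_nbhsl fuc).
by apply: filterS => y + w wy; rewrite -wy valL_val.
Qed.

End Smooth.

(** * Compatible and reflexive triples *)

Section Triples.
Context {R : realType} {X : Type} {D : plots R X} {F : set (X -> R)}.
Hypothesis hF : is_sikorski F.
Arguments D : clear implicits.

Lemma plot_nbhs (U : domain R) (p : U -> X) (u : U) (W : set X) :
  compatible_triple D F -> D U p -> nbhs (p u : initial_space F) W ->
  \forall y \near val u, exists2 w : U, val w = y & W (p w).
Proof.
move=> DF Dp /(nbhs_gauge hF)[q [Fq q0 _ qW]].
have : (q \o p) u < 1 by rewrite /= q0.
move=> /(smooth_near_lt (DF _ _ _ Dp Fq)).
by apply: filterS => y [w wy /qW Ww]; exists w.
Qed.

Lemma compatible_subset (V : set X) : compatible_triple D F ->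
  compatible_triple (subset_diffeology D V) (subspace_sikorski F V).
Proof.
move=> DF U p f Dp Ff; apply: smooth_on_near => _ /domain_val[u <-].
have [W pW [g Fg gf]] := Ff (p u).
exists U, ('valL_0 (g \o (fun w => val (p w)))); split=> //.
- exact: set_valP.
- exact: DF Dp Fg.
- apply: filterS (plot_nbhs (u := u) DF Dp pW) => y [w <- Ww].
  by rewrite !valL_val /= gf.
Qed.

Lemma reflexive_compatible : reflexive_triple D F -> compatible_triple D F.
Proof. by move=> [<- _] U p f Dp; exact. Qed.

(** The preimage of V is open, and on it p factors through V.  The factor p' is a
    plot of V since by reflexivity plots are recognised by the functions of F,
    and smoothness restricts to open subsets. *)
Lemma plot_preimage (V : set X) (U : domain R) (p : U -> X) (u : U) :
  reflexive_triple D F -> open (V : set (initial_space F)) -> D U p ->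
  V (p u) ->
  exists (A : set 'rV[R]_(Defs.dim U)) (oA : open A) (p' : Domain oA -> V),
  [/\ A (val u), subset_diffeology D V (Domain oA) p' &
    forall y, exists2 w : U, val w = val y & p w = val (p' y)].
Proof.
move=> rDF oV Dp Vpu; have DF := reflexive_compatible rDF.
pose pt := 'valL_(p u) p.
have ptE w : pt (val w) = p w by exact: valL_val.
pose A : set 'rV[R]_(Defs.dim U) := [set y | (U : set _) y /\ V (pt y)].
have oA : open A.
  rewrite openE => y [/domain_val[w <-] Vw].
  rewrite ptE in Vw.
  have nV : nbhs (p w : initial_space F) V by exact: open_nbhs_nbhs.
  have := plot_nbhs DF Dp nV.
  apply: filterS => _ [z <- Vz]; split; first exact: set_valP.
  by rewrite /= ptE.
pose p' (y : Domain oA) : V := SigSub (mem_set (set_valP y).2).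
have p'E (y : Domain oA) : exists2 w : U, val w = val y & p w = val (p' y).
  by exists (SigSub (mem_set (set_valP y).1)) => //=; rewrite -ptE.
exists A, oA, p'; split=> //.
  by split; [exact: set_valP | rewrite ptE].
rewrite /subset_diffeology /= -rDF.2 => f Ff.
apply: smooth_restrict (DF _ _ _ Dp Ff) => y.
by have [w wy pw] := p'E y; exists w => //=; rewrite pw.
Qed.

(** The function of F agreeing with f near v is f cut off by a function of the
    gauge of V: its support, contained in {q <= 2/3}, stays away from the
    complement of V, so extending by 0 preserves smoothness along plots. *)
Lemma Phi_subset_diffeology (V : set X) :
  reflexive_triple D F -> open (V : set (initial_space F)) ->
  Phi (subset_diffeology D V) `<=` subspace_sikorski F V.
Proof.
move=> rDF oV f Df v; have DF := reflexive_compatible rDF.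
have Vv : nbhs (val v : initial_space F) V.
  by apply: open_nbhs_nbhs; split=> //; exact: set_valP.
have [q [Fq q0 _ qV]] := nbhs_gauge hF Vv.
have [b [Fb b1 b0]] := sikorski_cutoff hF Fq.
exists [set x | q x < 1/3].
  by apply: nbhs_sikorski_lt => //; rewrite q0; lra.
exists (b * 'valL_0 f); last first.
  by move=> w /= /ltW/b1 bw; rewrite mulrfctE bw mul1r valL_val.
rewrite -rDF.1 => U p Dp; apply: smooth_on_near => _ /domain_val[u <-].
have [Vpu|nVpu] := pselect (V (p u)).
- have [A [oA [p' [Au Dp' p'E]]]] := plot_preimage rDF oV Dp Vpu.
  exists A, ('valL_0 (b \o p) * 'valL_0 (f \o p')); split=> //.
    apply: smooth_onM => //; last exact: Df Dp'.
    apply: smooth_on_sub (DF _ _ _ Dp Fb) => y Ay.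
    have [y' <-] := @domain_val _ (Domain oA) y Ay.
    by have [w <- _] := p'E y'; exact: set_valP.
  apply: filterS (open_nbhs_nbhs (conj oA Au)) => y Ay.
  have [y' <-] := @domain_val _ (Domain oA) y Ay.
  have [w wy pw] := p'E y'.
  rewrite mulrfctE [X in _ * X]valL_val -wy !valL_val/=.
  by rewrite mulrfctE pw valL_val.
- exists U, (cst 0); split.
  + exact: set_valP.
  + exact: (smooth_on_cst _ (@open_carrier _ U)).
  (* [smooth_near_lt] propagates upper bounds, hence the passage to - q. *)
  have sNq : smooth (-%R \o q \o p).
    apply: DF Dp _; rewrite (_ : -%R \o q = cst (-1) * q).
      by apply: sikorskiM => //; exact: sikorski_cst.
    by apply/funext => z; rewrite mulrfctE /= mulN1r.
  have q1 : (-%R \o q \o p) u < - (2/3).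
    have : 1 <= q (p u) by rewrite leNgt; apply/negP => /qV.
    by rewrite /=; lra.
  apply: filterS (smooth_near_lt sNq q1) => y [w <-].
  rewrite valL_val /= ltrN2 => /ltW/b0 bw.
  by rewrite mulrfctE bw mul0r.
Qed.

Lemma Pi_subspace_sikorski (V : set X) (U : domain R) :
  reflexive_triple D F ->
  Pi (subspace_sikorski F V) (U := U) `<=` subset_diffeology D V U.
Proof.
move=> rDF p Fp; rewrite /subset_diffeology /= -rDF.2 => f Ff.
apply: (Fp (f \o val)) => v; exists setT; first exact: filterT.
by exists f.
Qed.

End Triples.

Theorem proposition5p4 (R : realType) (X : Type) (D : plots R X)
    (F : set (X -> R)) (hD : is_diffeology D) (hF : is_sikorski F) :
  (forall V : set X, compatible_triple D F ->
     compatible_triple (subset_diffeology D V) (subspace_sikorski F V)) /\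
  (forall V : set X, reflexive_triple D F -> open (V : set (initial_space F)) ->
     reflexive_triple (subset_diffeology D V) (subspace_sikorski F V)).
Proof.
split=> [V|V rDF oV]; first exact: compatible_subset.
have DFV := compatible_subset hF (V := V) (reflexive_compatible rDF).
split.
  apply/seteqP; split; first exact: Phi_subset_diffeology.
  by move=> f Ff U p Dp; exact: DFV.
apply/functional_extensionality_dep => U; apply/seteqP; split.
  exact: Pi_subspace_sikorski.
by move=> p Dp f Ff; exact: DFV.
Qed.
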